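(* Let $n\ge 0$ and $n'=\lfloor n/2\rfloor$. For every $f\in\Lambda^*_n$ there exist unique $h_i\in\mathcal{H}_{n-2i}$ ($i=0,1,\ldots,n'$) such that $$f=h_0+Q_2h_1+Q_2^2h_2+\cdots+Q_2^{n'}h_{n'}.$$
   Context: Partitions are non-increasing sequences $\lambda=(\lambda_1,\lambda_2,\ldots)$ of non-negative integers, eventually $0$; $|\lambda|=\sum\lambda_i$. Let $\mathcal{S}$ be the set of non-increasing, eventually constant integer sequences. For $\lambda\in\mathcal{S}$ with eventual value $n$, define $Q_k(\lambda)$ ($k\ge0$) by $\sum_{k\ge0}Q_k(\lambda)z^{k-1}=e^{nz}\big(\frac{1}{e^{z/2}-e^{-z/2}}+\sum_{i\ge1}(e^{z(\lambda_i-n-i+1/2)}-e^{z(-i+1/2)})\big)$ (Laurent expansion at $z=0$). Then $Q_0=1$, $Q_1(\lambda)=n$, and $Q_2(\lambda)=|\lambda|-\tfrac1{24}$ on partitions. Let $\Lambda^*=\mathbb{Q}[Q_2,Q_3,\ldots]$ (functions on partitions) and $\mathcal{R}=\mathbb{Q}[Q_1,Q_2,\ldots]$ (functions on $\mathcal{S}$; the $Q_i$, $i\ge1$, are algebraically independent), graded by giving $Q_i$ weight $i$; subscript $n$ denotes the weight-$n$ part. With $Q_0:=1$, define on $\mathcal{R}$ the operators $\boldsymbol{\partial}=\sum_{m\ge0}Q_m\frac{\partial}{\partial Q_{m+1}}$, $\mathscr{D}=\sum_{k,\ell\ge0}\binom{k+\ell}{k}Q_{k+\ell}\frac{\partial^2}{\partial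 Q_{k+1}\partial Q_{\ell+1}}$, $\Delta=\tfrac12(\mathscr{D}-\boldsymbol{\partial}^2)$. Let $\mathcal{H}=\{f\in\Lambda^*:\Delta f\in Q_1\mathcal{R}\}$ and $\mathcal{H}_m=\mathcal{H}\cap\Lambda^*_m$ (with $\mathcal{H}_m=0$ for $m<0$). *)

(* Defs.v *)
From HB Require Import structures.
From mathcomp Require Import all_boot all_order all_algebra finmap.
From mathcomp Require Import monalg.

Set Implicit Arguments.
Unset Strict Implicit.
Unset Printing Implicit Defensive.

Import Order.TTheory GRing.Theory Num.Theory.
Local Open Scope ring_scope.

(* Sequences are indexed from 0: the mathematical lambda_i, i >= 1, is the
   term of index i - 1. *)

Record stable_seq := StableSeq {
  sterm :> nat -> int;
  slim : int; (* the eventual value *)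
  sterm_nonincr : forall i j : nat, (i <= j)%N -> sterm j <= sterm i;
  sterm_stable : exists N : nat, forall i : nat, (N <= i)%N -> sterm i = slim
}.

Record int_partition := IntPartition {
  pterm : nat -> nat;
  pterm_nonincr : forall i j : nat, (i <= j)%N -> (pterm j <= pterm i)%N;
  pterm_stable : exists N : nat, forall i : nat, (N <= i)%N -> pterm i = 0%N
}.

Lemma stable_of_partition_nonincr (la : int_partition) (i j : nat) :
  (i <= j)%N -> (pterm la j)%:Z <= (pterm la i)%:Z.
Proof. by move=> ij; rewrite lez_nat pterm_nonincr. Qed.

Lemma stable_of_partition_stable (la : int_partition) :
  exists N : nat, forall i : nat, (N <= i)%N -> (pterm la i)%:Z = 0%:Z.
Proof. by have [N HN] := pterm_stable la; exists N => i /HN ->. Qed.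

Definition stable_of_partition (la : int_partition) : stable_seq :=
  StableSeq (@stable_of_partition_nonincr la) (stable_of_partition_stable la).

Coercion stable_of_partition : int_partition >-> stable_seq.

Lemma stable_reached (s : stable_seq) : exists N : nat, s N == slim s.
Proof. by have [N HN] := sterm_stable s; exists N; rewrite HN. Qed.

(* By monotonicity, all terms from index slength s on equal the eventual
   value. *)
Definition slength (s : stable_seq) : nat := ex_minn (stable_reached s).

(* Formal power series over rat, as coefficient sequences. *)

Definition fps := nat -> rat.

Definition fps_add (a b : fps) : fps := fun k => a k + b k.

Definition fps_sub (a b : fps) : fps := fun k => a k - b k.

Definition fps_mul (a b : fps) : fps :=
  fun k => \sum_(i < k.+1) a i * b (k - i)%N.

(* e^(c z) *)
Definition fps_exp (c : rat) : fps := fun k => c ^+ k / k`!%:R.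

(* z * a(z) *)
Definition fps_mulX (a : fps) : fps := fun k => if k is k'.+1 then a k' else 0.

(* a(z) / z, for a with zero constant term *)
Definition fps_divX (a : fps) : fps := fun k => a k.+1.

(* The first k + 1 coefficients of 1 / a(z), for a 0 != 0. *)
Fixpoint fps_inv_prefix (a : fps) (k : nat) : seq rat :=
  if k is k'.+1 then
    let s := fps_inv_prefix a k' in
    rcons s (- (a 0%N)^-1 * \sum_(i < k) a (k - i)%N * s`_i)
  else [:: (a 0%N)^-1].

Definition fps_inv (a : fps) : fps := fun k => (fps_inv_prefix a k)`_k.

Lemma size_fps_inv_prefix (a : fps) (k : nat) :
  size (fps_inv_prefix a k) = k.+1.
Proof. by elim: k => //= k IH; rewrite size_rcons IH. Qed.

Lemma nth_fps_inv_prefix (a : fps) (k i : nat) :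
  (i <= k)%N -> (fps_inv_prefix a k)`_i = fps_inv a i.
Proof.
elim: k => [|k IH]; first by rewrite leqn0 => /eqP ->.
rewrite leq_eqVlt => /orP [/eqP -> //|]; rewrite ltnS => ik.
by rewrite /= nth_rcons size_fps_inv_prefix ltnS ik IH.
Qed.

Lemma fps_mul_inv (a : fps) (k : nat) :
  a 0%N != 0 -> fps_mul a (fps_inv a) k = (k == 0%N)%:R.
Proof.
move=> a0; rewrite /fps_mul; case: k => [|k].
  by rewrite big_ord1 /= mulfV.
rewrite big_ord_recl subn0 {1}/fps_inv /= nth_rcons size_fps_inv_prefix ltnn eqxx.
rewrite mulrA mulrN mulfV // mulN1r (reindex_inj rev_ord_inj) /=.
apply/eqP; rewrite addrC subr_eq0; apply/eqP/eq_bigr => i _.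
rewrite subKn //; congr (_ * _).
by rewrite subSS nth_fps_inv_prefix // leq_subr.
Qed.

(* The series sum_k Q_k(s) z^k, that is, z times
     e^(n z) (1 / (e^(z/2) - e^(-z/2))
              + sum_(i >= 1) (e^(z (s_i - n - i + 1/2)) - e^(z (-i + 1/2))))
   with n the eventual value of s; the summands with i > slength s vanish, and
   -i + 1/2 becomes -i - 1/2 with indices starting from 0. *)
Definition Qseries (s : stable_seq) : fps :=
  let n : rat := (slim s)%:~R in
  fps_mul (fps_exp n)
    (fps_add
       (fps_inv (fps_divX (fps_sub (fps_exp (1 / 2%:R)) (fps_exp (- (1 / 2%:R))))))
       (fps_mulX (fun k => \sum_(i < slength s)
          fps_sub (fps_exp ((s i)%:~R - n - i%:R - 1 / 2%:R))
                  (fps_exp (- i%:R - 1 / 2%:R)) k))).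

Definition Q (k : nat) (s : stable_seq) : rat := Qseries s k.

(* The ring R of polynomials in Q_1, Q_2, ... with rational coefficients; the
   variable of index i is Q_(i+1). As the functions Q_1, Q_2, ... on stable_seq
   are algebraically independent, evalR identifies it with the ring of
   functions they generate. *)

Definition Rring := {malg rat[{cmonom nat}]}.

Definition evalR (p : Rring) (s : stable_seq) : rat :=
  mmap idfun
    (fun m : {cmonom nat} => \prod_(i <- finsupp m) Q i.+1 s ^+ m i) p.

Definition varQ (k : nat) : Rring :=
  if k is i.+1 then << ucm i >> else 1.

Definition mweight (m : {cmonom nat}) : nat :=
  (\sum_(i <- finsupp m) i.+1 * m i)%N.

Definition homogR (n : nat) (p : Rring) : Prop :=
  forall m, m \in msupp p -> mweight m = n.

(* Membership in the subring of polynomials in Q_2, Q_3, ... *)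
Definition freeQ1 (p : Rring) : Prop := forall m, m \in msupp p -> m 0%N = 0%N.

(* The partial derivative with respect to Q_(i+1) *)
Definition partialQ (i : nat) (p : Rring) : Rring :=
  \sum_(m <- msupp p) << p@_m *+ m i *g divcm m (ucm i) >>.

(* A bound on the variables of p: partialQ i p = 0 for i >= nvars p, so the
   infinite sums defining the operators below stop there. *)
Definition nvars (p : Rring) : nat :=
  (\max_(m <- msupp p) \max_(i <- finsupp m) i.+1)%N.

Definition opPartial (p : Rring) : Rring :=
  \sum_(m < nvars p) varQ m * partialQ m p.

Definition opD (p : Rring) : Rring :=
  \sum_(k < nvars p) \sum_(l < nvars p)
    (varQ (k + l) * partialQ k (partialQ l p)) *+ 'C(k + l, k).

Definition Delta (p : Rring) : Rring :=
  (1 / 2%:R) *: (opD p - opPartial (opPartial p)).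

(* Functions on partitions. The polynomial p in Q_2, Q_3, ... representing an
   element of Lambda^* is unique by algebraic independence, and it is through p
   that the grading and Delta apply to functions. *)

Definition represents (p : Rring) (f : int_partition -> rat) : Prop :=
  freeQ1 p /\ forall la : int_partition, f la = evalR p la.

Definition in_Lambda_wt (n : nat) (f : int_partition -> rat) : Prop :=
  exists2 p : Rring, represents p f & homogR n p.

(* Membership in Q_1 R, as functions on stable_seq *)
Definition in_Q1R (g : stable_seq -> rat) : Prop :=
  exists q : Rring, forall s : stable_seq, g s = Q 1 s * evalR q s.

Definition in_H (f : int_partition -> rat) : Prop :=
  exists2 p : Rring, represents p f & in_Q1R (evalR (Delta p)).

Definition in_H_wt (n : nat) (f : int_partition -> rat) : Prop :=
  in_H f /\ in_Lambda_wt n f.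

(* Main.v *)
(** On polynomials in Q_2, Q_3, ... let L be Delta followed by Q_1 := 0, so that
    the harmonic elements are the kernel of L.  In weight w one has
      L (Q_2 p) = Q_2 L p + (w - 1/2) p,
    hence L (Q_2^i h) = i (w + i - 3/2) Q_2^(i-1) h for harmonic h, with a factor
    that never vanishes for i >= 1.  Existence follows by induction on the weight,
    correcting f by a preimage of L f, and uniqueness by applying L to a relation.

    Passing from functions to polynomials needs the algebraic independence of
    Q_2, Q_3, ... on partitions.  For partitions with at most M parts, Q_(k+1) is,
    up to constants, the k-th power sum of M distinct points.  One of the points
    may be moved arbitrarily far to the right, so a polynomial p vanishing on all
    partitions may be differentiated in each point; the resulting linear relations
    between the values of the partial derivatives of p form a Vandermonde system,
    so the partial derivatives vanish too and one concludes by induction on the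
    degree. *)

From Stdlib Require Import FunctionalExtensionality.
From HB Require Import structures.
From mathcomp Require Import all_boot all_order all_algebra finmap.
From mathcomp Require Import ring zify.
From mathcomp Require Import monalg.
Require Import Defs.

Set Implicit Arguments.
Unset Strict Implicit.
Unset Printing Implicit Defensive.

Import Order.TTheory GRing.Theory Num.Theory.
Local Open Scope ring_scope.

(** * The commutation relation between Delta and Q_2 *)

Section FirstAndSecondOrderOperators.

Variables (A : comAlgType rat) (x : nat -> A) (d : nat -> {linear A -> A}).
Hypothesis d_xM : forall i j p, d i (x j.+1 * p) = p *+ (i == j) + x j.+1 * d i p.

Definition dsum N p := \sum_(m < N) x m * d m p.
Definition ddsum N p :=
  \sum_(k < N) \sum_(l < N) (x (k + l) * d k (d l p)) *+ 'C(k + l, k).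
(** Truncation of the Euler operator for the weight grading, in which [x k.+1] has weight [k.+1]. *)
Definition eulersum N p := \sum_(k < N) (x k.+1 * d k p) *+ k.+1.

Lemma dsum_is_linear N : linear (dsum N).
Proof.
move=> c p q; rewrite scaler_sumr -big_split; apply: eq_bigr => m _ /=.
by rewrite linearP mulrDr scalerAr.
Qed.

Lemma ddsum_is_linear N : linear (ddsum N).
Proof.
move=> c p q; rewrite scaler_sumr -big_split; apply: eq_bigr => k _ /=.
rewrite scaler_sumr -big_split; apply: eq_bigr => l _ /=.
by rewrite !linearP /= mulrDr mulrnDl -scalerAr scalerMnr.
Qed.

Lemma sum_ord_natmul_eq N j (F : nat -> A) : (j < N)%N ->
  \sum_(m < N) F m *+ (m == j :> nat) = F j.
Proof.
move=> jN; rewrite (bigD1 (Ordinal jN)) //= eqxx mulr1n big1 ?addr0 // => m.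
by rewrite -val_eqE /= => /negPf ->; rewrite mulr0n.
Qed.

Lemma dsum_xM N j p : (j < N)%N ->
  dsum N (x j.+1 * p) = x j * p + x j.+1 * dsum N p.
Proof.
move=> jN; rewrite /dsum.
under eq_bigr => m _ do rewrite d_xM mulrDr mulrnAr mulrCA.
by rewrite big_split mulr_sumr (@sum_ord_natmul_eq N j (fun m => x m * p)).
Qed.

(** By the Leibniz rule, the correction consists of the cross terms with [k = 1] or [l = 1]. There
    the binomial coefficient is the weight of [x k.+1] or [x l.+1], so each family sums to the Euler
    operator. *)
Lemma ddsum_x2M N p : (1 < N)%N ->
  ddsum N (x 2 * p) = x 2 * ddsum N p + eulersum N p *+ 2.
Proof.
move=> N1; rewrite /ddsum.
have E k l : (x (k + l) * d k (d l (x 2 * p))) *+ 'C(k + l, k) =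
    x 2 * ((x (k + l) * d k (d l p)) *+ 'C(k + l, k))
    + (((x (k + l) * d k p) *+ 'C(k + l, k)) *+ (l == 1%N)
       + ((x (k + l) * d l p) *+ 'C(k + l, k)) *+ (k == 1%N)).
  rewrite d_xM linearD linearMn d_xM.
  move: (nat_of_bool _) (nat_of_bool _) 'C(_, _) => u v w; ring.
under eq_bigr => k _.
  under eq_bigr => l _ do rewrite E.
  rewrite !big_split /= -mulr_sumr.
  rewrite (@sum_ord_natmul_eq N 1 (fun l => (x (k + l)%N * d k p) *+ 'C(k + l, k))) //.
  over.
rewrite !big_split /= -mulr_sumr; congr (_ + _).
rewrite mulr2n; congr (_ + _).
  by apply: eq_bigr => k _; rewrite addn1 binSn.
rewrite exchange_big /=; apply: eq_bigr => l _.
rewrite (@sum_ord_natmul_eq N 1 (fun k => (x (k + l)%N * d l p) *+ 'C(k + l, k))) //.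
by rewrite add1n bin1.
Qed.

Lemma half_ddsum_dsum2_x2M N p : (1 < N)%N -> x 0 = 1 ->
  (1 / 2%:R) *: (ddsum N (x 2 * p) - dsum N (dsum N (x 2 * p))) =
  x 2 * ((1 / 2%:R) *: (ddsum N p - dsum N (dsum N p)))
  + (eulersum N p - (1 / 2%:R) *: p) - x 1 * dsum N p.
Proof.
move=> N1 x0; have N0 := ltnW N1.
have dsumD u v : dsum N (u + v) = dsum N u + dsum N v.
  by have := dsum_is_linear N 1 u v; rewrite !scale1r.
rewrite ddsum_x2M // dsum_xM // dsumD !dsum_xM // x0 mul1r.
set P := dsum N p; set PP := dsum N P; set E := eulersum N p.
(* Trading the scalar 1/2 for an element [c] of the algebra puts everything in reach of [ring]: the
   two sides differ by $(2c-1)(E - x_1P)$. *)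
have [c hc hs] : exists2 c : A, c *+ 2 = 1 & forall u, (1 / 2%:R) *: u = c * u.
  exists (1 / 2%:R)%:A => [|u]; last by rewrite mulr_algl.
  by rewrite scalerMnl -mulr_natr mul1r mulVf ?scale1r // pnatr_eq0.
rewrite !hs.
apply/eqP; rewrite -subr_eq0; apply/eqP.
transitivity ((c *+ 2 - 1) * (E - x 1 * P)); first ring.
by rewrite hc subrr mul0r.
Qed.

End FirstAndSecondOrderOperators.

(** * Harmonic decomposition *)

Section HarmonicDecomposition.

(** An sl2-like situation: [V n] models the part of weight [n], [x] (later $Q_2$) raises the weight
    by 2, [L] lowers it by 2, and their commutator is a scalar on each weight. *)
Variables (A : comAlgType rat) (V : nat -> A -> Prop) (L : {linear A -> A}) (x : A).

Hypothesis V0 : forall n, V n 0.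
Hypothesis VP : forall n c p q, V n p -> V n q -> V n (c *: p + q).
Hypothesis V_xM : forall n p, V n p -> V n.+2 (x * p).
Hypothesis V_L : forall n p, V n.+2 p -> V n (L p).
Hypothesis L_small : forall n p, (n < 2)%N -> V n p -> L p = 0.
Hypothesis L_xM : forall n p, V n p -> L (x * p) = x * L p + (n%:R - 1 / 2%:R) *: p.

(** This is $\sum_{j<i}(w+2j-\tfrac12)$, the commutator scalars collected while [L] moves past [i]
    factors [x]. *)
Definition lowering_coef (i w : nat) : rat := i%:R * (w%:R + i%:R - 3%:R / 2%:R).

(** The second factor is an integer minus 3/2; were it zero, doubling would make 3 even. *)
Lemma lowering_coef_neq0 i w : lowering_coef i.+1 w != 0.
Proof.
rewrite /lowering_coef mulf_neq0 ?pnatr_eq0 // subr_eq0 -natrD.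
apply/eqP => /(congr1 (fun r : rat => r * 2%:R)).
rewrite mulfVK ?pnatr_eq0 // -natrM => /eqP; rewrite eqr_nat => /eqP; lia.
Qed.

Lemma V_xnM n i p : V n p -> V (n + i.*2) (x ^+ i * p).
Proof.
move=> Vp; elim: i => [|i IH]; first by rewrite expr0 mul1r addn0.
by rewrite exprS -mulrA doubleS !addnS; apply: V_xM.
Qed.

Lemma L_xnM n i h : V n h -> L h = 0 ->
  L (x ^+ i.+1 * h) = lowering_coef i.+1 n *: (x ^+ i * h).
Proof.
move=> Vh Lh; elim: i => [|i IH].
  rewrite expr1 (L_xM Vh) Lh mulr0 add0r expr0 (mul1r h); congr (_ *: _).
  by rewrite /lowering_coef mul1r; field.
rewrite exprS -mulrA (L_xM (V_xnM i.+1 Vh)) IH -scalerAr mulrA -exprS -scalerDl.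
congr (_ *: _); rewrite /lowering_coef -!natr1 natrD -muln2 natrM -!natr1; by field.
Qed.

Lemma harmonic_decomp n f : V n f ->
  exists h : nat -> A,
    (forall i, (i <= n./2)%N -> V (n - 2 * i) (h i) /\ L (h i) = 0) /\
    f = \sum_(i < (n./2).+1) x ^+ i * h i.
Proof.
have [m] := ubnP n; elim: m => // m IH in n f *; rewrite ltnS => nm Vf.
have [n2|n2] := ltnP n 2.
  exists (fun _ => f); have -> : n./2 = 0%N by lia.
  split=> [i|]; last by rewrite big_ord1 expr0 mul1r.
  by rewrite leqn0 => /eqP ->; rewrite muln0 subn0 (L_small n2 Vf).
case: n n2 nm Vf => [|[|n]] // _ nm Vf.
have [g [gV Lf]] := IH n (L f) (ltnW nm) (V_L Vf).
(* The rescaling makes [L] send $x^{i+1}g'_i$ to $x^ig_i$, so the sum [s] below satisfies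
   [L s = L f] and [f - s] can serve as the component of index 0. *)
pose g' i := (lowering_coef i.+1 (n - 2 * i))^-1 *: g i.
have g'V i : (i <= n./2)%N -> V (n - 2 * i) (g' i) /\ L (g' i) = 0.
  move=> /gV[Vg Lg]; split; last by rewrite linearZ /= Lg scaler0.
  by rewrite /g' -[_ *: _]addr0; apply: VP.
pose s := \sum_(i < (n./2).+1) x ^+ i.+1 * g' i.
have Vs : V n.+2 s.
  rewrite /s; elim/big_ind: _ => [//|p q Vp Vq|i _].
    by rewrite -[p]scale1r; apply: VP.
  have [Vg _] := g'V i (leq_ord i).
  by have := V_xnM i.+1 Vg; congr V; have := leq_ord i; lia.
have Ls : L s = L f.
  rewrite Lf linear_sum; apply: eq_bigr => i _ /=.
  have [Vg Lg] := g'V i (leq_ord i).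
  by rewrite (L_xnM _ Vg Lg) -scalerAr scalerA mulfV ?scale1r // lowering_coef_neq0.
exists (fun i => if i is i'.+1 then g' i' else f - s); split=> [[_|i]|].
- split; last by rewrite linearB /= Ls subrr.
  by rewrite muln0 subn0 addrC -scaleN1r; apply: VP.
- by rewrite /= ltnS => /g'V; congr (V _ _ /\ _); lia.
by rewrite /= big_ord_recl expr0 mul1r /= subrK.
Qed.

(** Applying [L] removes the term of index 0 and leaves a relation of length [K - 1] between nonzero
    multiples of the later components. The weights [w] are arbitrary so that the induction can shift
    them. *)
Lemma harmonic_decomp_unique K (h : nat -> A) (w : nat -> nat) :
  (forall i, (i < K)%N -> V (w i) (h i) /\ L (h i) = 0) ->
  \sum_(i < K) x ^+ i * h i = 0 -> forall i, (i < K)%N -> h i = 0.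
Proof.
elim: K => [|K IH] in h w * => // hV.
rewrite big_ord_recl expr0 mul1r => E.
have h0 i : (i < K)%N -> h i.+1 = 0.
  move=> iK; apply/eqP.
  have := IH (fun i => lowering_coef i.+1 (w i.+1) *: h i.+1) (fun i => w i.+1) _ _ i iK.
  move=> H; have /eqP : lowering_coef i.+1 (w i.+1) *: h i.+1 = 0.
    apply: H => [j jK|]; first have [Vh Lh] := hV j.+1 jK.
      split; last by rewrite linearZ /= Lh scaler0.
      by rewrite -[_ *: _]addr0; apply: VP.
    move/(congr1 L): E; rewrite linearD (proj2 (hV 0%N isT)) add0r linear0.
    rewrite linear_sum => EL; rewrite -[RHS]EL.
    apply: eq_bigr => j _; have [Vh Lh] := hV j.+1 (ltn_ord j).
    by rewrite -scalerAr /= /bump /= add1n (L_xnM _ Vh Lh).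
  by rewrite scaler_eq0 (negPf (lowering_coef_neq0 _ _)).
case=> [_|i]; last exact: h0.
by rewrite -E big1 ?addr0 // => i _; rewrite h0 ?mulr0.
Qed.

End HarmonicDecomposition.

(** * Differential operators on the ring R *)

Lemma malg_ind (P : Rring -> Prop) :
  P 0 -> (forall c m p, P p -> P (<< c *g m >> + p)) -> forall p, P p.
Proof. by move=> P0 PD p; rewrite [p]monalgE; elim/big_rec: _ => // m q _; apply: PD. Qed.

Lemma mulcm_divcm (m : {cmonom nat}) (i : nat) :
  m i != 0%N -> mulcm (ucm i) (divcm m (ucm i)) = m.
Proof.
move=> mi; apply/eqP/cmP => j; rewrite mulcmE divcmE ucmE.
by case: eqVneq => [<-|_] /=; [rewrite subnKC // lt0n | rewrite subn0].
Qed.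

Lemma divcm_mulcm (m : {cmonom nat}) (i : nat) : divcm (mulcm (ucm i) m) (ucm i) = m.
Proof. by apply/eqP/cmP => j; rewrite divcmE mulcmE addKn. Qed.

Lemma mcoeff_partialQ i p m :
  (partialQ i p)@_m = p@_(mulcm (ucm i) m) *+ (m i).+1.
Proof.
rewrite /partialQ raddf_sum /=; under eq_bigr do rewrite mcoeffU.
(* Division of monomials truncates, so a monomial without the variable [i] is left unchanged by it;
   such a term is killed by its factor [m' i = 0]. *)
have E m' : m' != mulcm (ucm i) m ->
    p@_m' *+ m' i *+ (divcm m' (ucm i) == m) = 0.
  move=> ne; have [->|mi] := eqVneq (m' i) 0%N; first by rewrite mulr0n mul0rn.
  case: eqP => // E; move: ne; rewrite -E mulcm_divcm // eqxx //.
case: (boolP (mulcm (ucm i) m \in msupp p)) => [h|h].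
  rewrite (bigD1_seq _ h) ?fset_uniq //= big1 => [|m' /E //].
  by rewrite addr0 divcm_mulcm eqxx mulcmE ucmE eqxx.
rewrite (mcoeff_outdom h) mul0rn big1_seq // => m' /andP[_ hm']; apply: E.
by apply: contraNneq h => <-.
Qed.

Lemma mcoeffP (K : choiceType) (R : nzRingType) c (p q : {malg R[K]}) k :
  (c *: p + q)@_k = c * p@_k + q@_k.
Proof. by rewrite mcoeffD mcoeffZ. Qed.

Lemma partialQ_is_linear i : linear (partialQ i).
Proof.
move=> c p q; apply/malgP => m.
rewrite [RHS]mcoeffP [LHS]mcoeff_partialQ mcoeffP mulrnDl.
by rewrite [X in _ = c * X + _]mcoeff_partialQ [X in _ = _ + X]mcoeff_partialQ mulrnAr.
Qed.

HB.instance Definition _ i :=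
  GRing.isLinear.Build rat Rring Rring *:%R (partialQ i) (partialQ_is_linear i).

Lemma partialQU i c m :
  partialQ i << c *g m >> = << c *+ m i *g divcm m (ucm i) >>.
Proof.
apply/malgP => m'; rewrite mcoeff_partialQ !mcoeffU.
have [->|ne] := eqVneq m (mulcm (ucm i) m').
  by rewrite divcm_mulcm eqxx mulcmE ucmE eqxx.
rewrite mulr0n mul0rn; have [->|mi] := eqVneq (m i) 0%N; first by rewrite mulr0n mul0rn.
by case: eqP => // E; move: ne; rewrite -E mulcm_divcm // eqxx.
Qed.

Lemma varQSU j c m : varQ j.+1 * << c *g m >> = << c *g mulcm (ucm j) m >>.
Proof. by rewrite /= malgM_def fgmulUU mul1r. Qed.

Lemma additive_ext (V : zmodType) (f g : Rring -> V) :
  {morph f : p q / p + q} -> {morph g : p q / p + q} ->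
  (forall c m, f << c *g m >> = g << c *g m >>) -> f =1 g.
Proof.
move=> fD gD h; elim/malg_ind => [|c m p IH]; last by rewrite fD gD h IH.
(* The base case needs [f 0 = g 0], which holds because 0 is the term with coefficient 0. *)
by rewrite -(@monalgU0 _ rat (onecm nat)) h.
Qed.

(** The Leibniz rule assumed as [d_xM] in the abstract computation, checked on single terms. *)
Lemma partialQ_varQM i j p :
  partialQ i (varQ j.+1 * p) = p *+ (i == j) + varQ j.+1 * partialQ i p.
Proof.
move: p; apply: additive_ext => [p q|p q|c m].
- by rewrite mulrDr linearD.
- by rewrite linearD mulrDr mulrnDl addrACA.
rewrite varQSU [LHS]partialQU [partialQ _ _]partialQU varQSU mulcmE ucmE.
have [->|ne] := eqVneq i j.
  rewrite divcm_mulcm mulr1n.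
  have [->|mj] := eqVneq (m j) 0%N; first by rewrite mulr0n monalgU0 addr0.
  by rewrite mulcm_divcm // -monalgUD /= mulrS.
suff -> : divcm (mulcm (ucm j) m) (ucm i) = mulcm (ucm j) (divcm m (ucm i)).
  by rewrite [RHS]add0r.
apply/eqP/cmP => k; rewrite !(divcmE, mulcmE, ucmE).
have [<-|_] := eqVneq j k; last by rewrite !add0n.
by rewrite (negPf ne) !subn0.
Qed.

Lemma varQ_partialQ i p :
  varQ i.+1 * partialQ i p = \sum_(m <- msupp p) << p@_m *+ m i *g m >>.
Proof.
rewrite /partialQ mulr_sumr; apply: eq_bigr => m _; rewrite varQSU.
have [->|mj] := eqVneq (m i) 0%N; first by rewrite mulr0n !monalgU0.
by rewrite mulcm_divcm.
Qed.

(** * Truncating the operators at a common bound on the variables *)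

Definition bounded (N : nat) (p : Rring) :=
  forall m, m \in msupp p -> forall i, (N <= i)%N -> m i = 0%N.

Lemma bounded_nvars p : bounded (nvars p) p.
Proof.
move=> m mp i; apply: contraTeq => mi; rewrite -ltnNge /nvars.
rewrite (big_rem _ mp) /= leq_max (big_rem i) ?leq_max ?leqnn //=.
by rewrite -cmE_neq0.
Qed.

Lemma bounded_le N N' p : (N <= N')%N -> bounded N p -> bounded N' p.
Proof. by move=> le b m mp i /(leq_trans le); apply: b. Qed.

Lemma nvars_le N p : bounded N p -> (nvars p <= N)%N.
Proof.
move=> b; rewrite /nvars; apply/bigmax_leqP_seq => m mp _.
apply/bigmax_leqP_seq => i im _; rewrite ltnNge; apply/negP => le.
by move: im; rewrite -cmE_neq0 (b m mp i le).
Qed.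

Lemma partialQ_bounded0 N p i : bounded N p -> (N <= i)%N -> partialQ i p = 0.
Proof.
move=> b le; rewrite /partialQ big1_seq // => m /andP[_ mp].
by rewrite (b m mp i le) mulr0n monalgU0.
Qed.

Lemma bounded_partialQ N p i : bounded N p -> bounded N (partialQ i p).
Proof.
move=> b m; rewrite -mcoeff_neq0 mcoeff_partialQ => h j le.
have mp : mulcm (ucm i) m \in msupp p.
  by rewrite -mcoeff_neq0; apply: contra_neq h => ->; rewrite mul0rn.
by have /eqP := b _ mp j le; rewrite mulcmE addn_eq0 => /andP[_ /eqP].
Qed.

Lemma boundedD N p q : bounded N p -> bounded N q -> bounded N (p + q).
Proof.
move=> bp bq m /(fsubsetP (msuppD_le p q)); rewrite inE => /orP[]; [exact: bp | exact: bq].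
Qed.

Lemma boundedZ N c p : bounded N p -> bounded N (c *: p).
Proof. by move=> b m /(fsubsetP (msuppZ_le c p)); apply: b. Qed.

Lemma msupp_varQM j (p : Rring) m : m \in msupp (varQ j.+1 * p) ->
  exists2 m', m' \in msupp p & m = mulcm (ucm j) m'.
Proof.
move=> /msuppM_le [m1 [m2 [h1 [h2 ->]]]].
by move/(fsubsetP msuppU_le)/fset1P: h1 => ->; exists m2.
Qed.

Lemma bounded_varQM N j p : (j <= N)%N -> bounded N p -> bounded N (varQ j * p).
Proof.
case: j => [_|j lj] b; first by rewrite mul1r.
move=> m /msupp_varQM[m' m'p ->] i le; rewrite mulcmE ucmE (b _ m'p _ le) addn0.
by case: eqP => // E; move: lj; rewrite E ltnNge le.
Qed.

Lemma sum_ord_widen (N N' : nat) (F : nat -> Rring) : (N <= N')%N ->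
  (forall i, (N <= i)%N -> F i = 0) -> \sum_(i < N) F i = \sum_(i < N') F i.
Proof.
move=> le h; rewrite (big_ord_widen _ F le) [RHS](bigID (fun i : 'I_N' => (i < N)%N)) /=.
by rewrite [X in _ + X]big1 ?addr0 // => i; rewrite -leqNgt => /h.
Qed.

Lemma opPartialE N p : bounded N p -> opPartial p = \sum_(m < N) varQ m * partialQ m p.
Proof.
move=> b; rewrite /opPartial; apply: (@sum_ord_widen _ _ (fun m => varQ m * partialQ m p)).
  exact: nvars_le.
by move=> i /(partialQ_bounded0 (@bounded_nvars p)) ->; rewrite mulr0.
Qed.

Lemma opDE N p : bounded N p -> opD p =
  \sum_(k < N) \sum_(l < N) (varQ (k + l) * partialQ k (partialQ l p)) *+ 'C(k + l, k).
Proof.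
move=> b; rewrite /opD.
have le := nvars_le b; have b' := @bounded_nvars p.
pose F k l := (varQ (k + l) * partialQ k (partialQ l p)) *+ 'C(k + l, k).
transitivity (\sum_(k < nvars p) \sum_(l < N) F k l).
  apply: eq_bigr => k _; apply: (@sum_ord_widen _ _ (F k)) => // i hi.
  by rewrite /F (partialQ_bounded0 b' hi) raddf0 mulr0 mul0rn.
apply: (@sum_ord_widen _ _ (fun k => \sum_(l < N) F k l)) => // i hi.
rewrite big1 // => l _.
by rewrite /F (partialQ_bounded0 (bounded_partialQ (i := l) b') hi) mulr0 mul0rn.
Qed.

Lemma bounded2 p q : exists2 N, bounded N p & bounded N q.
Proof.
exists (maxn (nvars p) (nvars q)).
  by apply: bounded_le (@bounded_nvars p); rewrite leq_maxl.
by apply: bounded_le (@bounded_nvars q); rewrite leq_maxr.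
Qed.

Notation dQ := (fun i => partialQ i : {linear Rring -> Rring}).

Lemma bounded_sum N (I : Type) (r : seq I) (F : I -> Rring) :
  (forall i, bounded N (F i)) -> bounded N (\sum_(i <- r) F i).
Proof.
move=> h; elim/big_ind: _ => [|p q|i _]; [|exact: boundedD|exact: h].
by move=> m; rewrite msupp0.
Qed.

Lemma opPartial_dsum N p : bounded N p -> opPartial p = dsum varQ dQ N p.
Proof. exact: opPartialE. Qed.

Lemma opD_ddsum N p : bounded N p -> opD p = ddsum varQ dQ N p.
Proof. exact: opDE. Qed.

Lemma bounded_opPartial N p : bounded N p -> bounded N (opPartial p).
Proof.
move=> b; rewrite (opPartialE b); apply: bounded_sum => i.
by apply: bounded_varQM; [exact: ltnW | exact: bounded_partialQ].
Qed.

Lemma Delta_sum N p : bounded N p ->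
  Delta p = (1 / 2%:R) *: (ddsum varQ dQ N p - dsum varQ dQ N (dsum varQ dQ N p)).
Proof.
move=> b; rewrite /Delta (opD_ddsum b) (opPartial_dsum (bounded_opPartial b)).
by rewrite (opPartial_dsum b).
Qed.

Lemma linear_half (A : lmodType rat) (F G : A -> A) : linear F -> linear G ->
  linear (fun p => (1 / 2%:R) *: (F p - G (G p))).
Proof.
move=> lF lG c p q; rewrite lF !lG opprD addrACA -scalerBr scalerDr !scalerA.
by rewrite mulrC.
Qed.

(** [Delta p] sums up to [nvars p], which varies with [p]; a bound common to [p] and [q] turns all
    the sums into fixed linear operators. *)
Lemma Delta_is_linear : linear Delta.
Proof.
move=> c p q; have [N bp bq] := bounded2 p q.
rewrite (Delta_sum bp) (Delta_sum bq) (Delta_sum (boundedD (boundedZ bp) bq)).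
by apply: linear_half; [apply: ddsum_is_linear | apply: dsum_is_linear].
Qed.

HB.instance Definition _ :=
  GRing.isLinear.Build rat Rring Rring *:%R Delta Delta_is_linear.

(** * Weights and homogeneity *)

Lemma mweightE N (m : {cmonom nat}) : (forall i, (N <= i)%N -> m i = 0%N) ->
  mweight m = (\sum_(i < N) i.+1 * m i)%N.
Proof.
move=> h; rewrite /mweight -(big_mkord xpredT (fun i => i.+1 * m i)%N).
rewrite [RHS](bigID (fun i => i \in finsupp m)) /= [X in (_ + X)%N]big1 ?addn0; last first.
  by move=> i; rewrite -cmE_eq0 => /eqP ->; rewrite muln0.
rewrite -[RHS]big_filter; apply: perm_big; apply: uniq_perm.
- exact: fset_uniq.
- by rewrite filter_uniq // iota_uniq.
move=> i; rewrite mem_filter mem_index_iota /=; case: (boolP (i \in _)) => //=.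
rewrite -cmE_neq0 => mi; symmetry; rewrite ltnNge; apply: contra mi => /h ->.
by [].
Qed.

Lemma finsupp_bound (m : {cmonom nat}) : exists N, forall i, (N <= i)%N -> m i = 0%N.
Proof.
exists (\max_(i <- finsupp m) i.+1)%N => i; apply: contraTeq => mi; rewrite -ltnNge.
by rewrite (big_rem i) ?leq_max ?leqnn //= -cmE_neq0.
Qed.

Lemma mweight_mulcm j (m : {cmonom nat}) :
  mweight (mulcm (ucm j) m) = (j.+1 + mweight m)%N.
Proof.
have [N hN] := finsupp_bound m.
have le1 := leq_maxl N j.+1; have le2 := leq_maxr N j.+1.
rewrite (@mweightE (maxn N j.+1)); last first.
  move=> i hi; rewrite mulcmE ucmE hN ?(leq_trans le1) // addn0.
  by case: eqP => // E; move: (leq_trans le2 hi); rewrite E ltnn.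
rewrite (@mweightE (maxn N j.+1) m); last by move=> i /(leq_trans le1)/hN.
under eq_bigr do rewrite mulcmE mulnDr.
rewrite big_split /=; congr (_ + _)%N.
rewrite (bigD1 (Ordinal le2)) //= ucmE eqxx muln1 big1 ?addn0 // => i.
by rewrite -val_eqE /= eq_sym ucmE => /negPf ->; rewrite muln0.
Qed.

(** Each monomial is an eigenvector of the Euler operator, with its weight as eigenvalue. *)
Lemma eulersum_homog N w p : bounded N p -> homogR w p ->
  eulersum varQ dQ N p = p *+ w.
Proof.
move=> b hw; rewrite /eulersum.
transitivity (\sum_(k < N) \sum_(m <- msupp p) << p@_m *+ (k.+1 * m k) *g m >> : Rring).
  apply: eq_bigr => k _; rewrite varQ_partialQ -sumrMnl; apply: eq_bigr => m _.
  by rewrite -monalgUMn -mulrnA mulnC.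
rewrite exchange_big /= [p in RHS]monalgE -sumrMnl big_seq [RHS]big_seq.
apply: eq_bigr => m mp; rewrite -monalgUMn -(hw m mp) (mweightE (b m mp)).
by rewrite -(raddf_sum (mkmalgU m)) sumrMnr.
Qed.

Lemma Delta_Q2M w p : homogR w p ->
  Delta (varQ 2 * p) =
  varQ 2 * Delta p + (w%:R - 1 / 2%:R) *: p - varQ 1 * opPartial p.
Proof.
(* The bound must be at least 2 for the variable $Q_2$, of index 1, to be in range. *)
move=> hw; pose N := maxn (nvars p) 2.
have bp : bounded N p by apply: bounded_le (@bounded_nvars p); rewrite leq_maxl.
have N1 : (1 < N)%N by rewrite leq_max leqnn orbT.
rewrite (Delta_sum bp) (Delta_sum (bounded_varQM N1 bp)) (opPartial_dsum bp).
rewrite scalerBl scaler_nat -(eulersum_homog bp hw).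
exact: (half_ddsum_dsum2_x2M partialQ_varQM).
Qed.

(* [p] is homogeneous of weight [b - a], in particular zero if [b < a]. *)
Definition homogDiff (a b : nat) (p : Rring) :=
  forall m, m \in msupp p -> (mweight m + a)%N = b.

Lemma homogDiff0 a b : homogDiff a b 0.
Proof. by move=> m; rewrite msupp0. Qed.

Lemma homogDiffD a b p q : homogDiff a b p -> homogDiff a b q -> homogDiff a b (p + q).
Proof.
move=> hp hq m /(fsubsetP (msuppD_le p q)); rewrite inE => /orP[]; [exact: hp|exact: hq].
Qed.

Lemma homogDiffZ a b c p : homogDiff a b p -> homogDiff a b (c *: p).
Proof. by move=> h m /(fsubsetP (msuppZ_le c p)); apply: h. Qed.

Lemma homogDiffMn a b n p : homogDiff a b p -> homogDiff a b (p *+ n).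
Proof. by move=> h m /(fsubsetP (msuppMn_le p n)); apply: h. Qed.

Lemma homogDiff_sum a b (I : Type) (r : seq I) (F : I -> Rring) :
  (forall i, homogDiff a b (F i)) -> homogDiff a b (\sum_(i <- r) F i).
Proof.
by move=> h; elim/big_ind: _ => [|p q|i _]; [exact: homogDiff0|exact: homogDiffD|exact: h].
Qed.

Lemma homogDiff_varQM a b j p : homogDiff (a + j) b p -> homogDiff a b (varQ j * p).
Proof.
case: j => [|j] h; first by rewrite mul1r -[a]addn0.
by move=> m /msupp_varQM[m' /h <- ->]; rewrite mweight_mulcm; lia.
Qed.

Lemma homogDiff_partialQ a b i p :
  homogDiff a b p -> homogDiff (a + i.+1) b (partialQ i p).
Proof.
move=> h m; rewrite -mcoeff_neq0 mcoeff_partialQ => hm.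
have /h <- : mulcm (ucm i) m \in msupp p.
  by rewrite -mcoeff_neq0; apply: contra_neq hm => ->; rewrite mul0rn.
by rewrite mweight_mulcm; lia.
Qed.

Lemma homogDiff_opPartial a b p : homogDiff a b p -> homogDiff a.+1 b (opPartial p).
Proof.
move=> h; apply: homogDiff_sum => i; apply: homogDiff_varQM.
by rewrite addSnnS; apply: homogDiff_partialQ.
Qed.

(** In [opD], two derivatives remove weight $k+\ell+2$ and the factor $Q_{k+\ell}$ restores
    $k+\ell$; each [opPartial] lowers the weight by 1. *)
Lemma homogDiff_Delta a b p : homogDiff a b p -> homogDiff a.+2 b (Delta p).
Proof.
move=> h; apply: homogDiffZ; apply: homogDiffD; last first.
  rewrite -scaleN1r; apply: homogDiffZ.
  by do 2!apply: homogDiff_opPartial.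
apply: homogDiff_sum => k; apply: homogDiff_sum => l; apply: homogDiffMn.
apply: homogDiff_varQM.
have -> : (a.+2 + (k + l) = a + l.+1 + k.+1)%N by lia.
by do 2!apply: homogDiff_partialQ.
Qed.

(* The substitution Q_1 := 0. *)
Definition killQ1 (p : Rring) : Rring :=
  \sum_(m <- msupp p) << p@_m *+ (m 0%N == 0%N) *g m >>.

Lemma mcoeff_killQ1 p m : (killQ1 p)@_m = p@_m *+ (m 0%N == 0%N).
Proof.
rewrite /killQ1 raddf_sum /=; under eq_bigr do rewrite mcoeffU.
case: (boolP (m \in msupp p)) => [h|h].
  rewrite (bigD1_seq _ h) ?fset_uniq //= big1 => [|m' /negPf -> //].
  by rewrite addr0 eqxx.
rewrite (mcoeff_outdom h) mul0rn big1_seq // => m' /andP[_ hm'].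
by have [E|//] := eqVneq m' m; move: h; rewrite -E hm'.
Qed.

Lemma killQ1_is_linear : linear killQ1.
Proof.
move=> c p q; apply/malgP => m.
rewrite [RHS]mcoeffP [LHS]mcoeff_killQ1 mcoeffP mulrnDl.
by rewrite [X in _ = c * X + _]mcoeff_killQ1 [X in _ = _ + X]mcoeff_killQ1 mulrnAr.
Qed.

HB.instance Definition _ :=
  GRing.isLinear.Build rat Rring Rring *:%R killQ1 killQ1_is_linear.

Lemma killQ1U c m : killQ1 << c *g m >> = << c *+ (m 0%N == 0%N) *g m >>.
Proof.
apply/malgP => m'; rewrite [LHS]mcoeff_killQ1 [RHS]mcoeffU mcoeffU.
by have [->|_] := eqVneq m m'; rewrite ?mulr1n ?mulr0n ?mul0rn.
Qed.

Lemma msupp_killQ1 p m : m \in msupp (killQ1 p) -> m \in msupp p /\ m 0%N = 0%N.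
Proof.
rewrite -!mcoeff_neq0 [X in X != _]mcoeff_killQ1.
by have [->|_] := eqVneq (m 0%N) 0%N; rewrite ?mulr0n ?eqxx.
Qed.

Lemma freeQ1_killQ1 p : freeQ1 (killQ1 p).
Proof. by move=> m /msupp_killQ1[]. Qed.

Lemma homogDiff_killQ1 a b p : homogDiff a b p -> homogDiff a b (killQ1 p).
Proof. by move=> h m /msupp_killQ1[/h]. Qed.

Lemma killQ1_id p : freeQ1 p -> killQ1 p = p.
Proof.
move=> h; apply/malgP => m; rewrite [LHS]mcoeff_killQ1.
have [/h ->|nm] := boolP (m \in msupp p); first by rewrite mulr1n.
by rewrite (mcoeff_outdom nm) mul0rn.
Qed.

Lemma killQ1_Q1M p : killQ1 (varQ 1 * p) = 0.
Proof.
move: p; apply: additive_ext => [p q|p q|c m].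
- by rewrite mulrDr linearD.
- by rewrite addr0.
by rewrite varQSU killQ1U mulcmE ucmE mulr0n monalgU0.
Qed.

Lemma killQ1_varQM j p : killQ1 (varQ j.+2 * p) = varQ j.+2 * killQ1 p.
Proof.
move: p; apply: additive_ext => [p q|p q|c m].
- by rewrite mulrDr linearD.
- by rewrite linearD mulrDr.
by rewrite varQSU [LHS]killQ1U [killQ1 _]killQ1U varQSU mulcmE ucmE.
Qed.

(** Together with [killQ1_Q1M], this makes [killQ1] the reduction modulo the ideal generated by
    $Q_1$. *)
Lemma killQ1_mod p : exists q, p = killQ1 p + varQ 1 * q.
Proof.
elim/malg_ind: p => [|c m p [q E]].
  by exists 0; rewrite mulr0 addr0 linear0.
have KD : killQ1 (<< c *g m >> + p) = << c *+ (m 0%N == 0%N) *g m >> + killQ1 p.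
  by rewrite -killQ1U; exact: linearD.
have [m0|m0] := eqVneq (m 0%N) 0%N.
  exists q; rewrite KD m0 mulr1n -[RHS]addrA.
  exact: (congr1 (+%R _) E).
exists (<< c *g divcm m (ucm 0) >> + q).
rewrite KD mulrDr varQSU mulcm_divcm // (negPf m0) monalgU0 add0r.
by rewrite [RHS]addrCA; exact: (congr1 (+%R _) E).
Qed.

(** * The Laplacian on polynomials in $Q_2, Q_3, \ldots$ *)

Definition LaplaceQ : Rring -> Rring := killQ1 \o Delta.
HB.instance Definition _ := GRing.Linear.on LaplaceQ.

(** Setting $Q_1$ to 0 discards the term $Q_1\boldsymbol{\partial}p$ of [Delta_Q2M] and fixes [p],
    which is free of $Q_1$. *)
Lemma LaplaceQ_Q2M w p : freeQ1 p -> homogR w p ->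
  LaplaceQ (varQ 2 * p) = varQ 2 * LaplaceQ p + (w%:R - 1 / 2%:R) *: p.
Proof.
move=> fp hp; rewrite /LaplaceQ /= (Delta_Q2M hp).
have kB a b : killQ1 (a - b) = killQ1 a - killQ1 b by exact: linearB.
have kP a b c : killQ1 (a + b *: c) = killQ1 a + b *: killQ1 c.
  by rewrite addrC [RHS]addrC; exact: linearP.
rewrite [LHS]kB [X in X - _]kP [X in _ - X]killQ1_Q1M [LHS]subr0.
by rewrite [X in X + _ = _]killQ1_varQM [X in _ + _ *: X = _](killQ1_id fp).
Qed.

Definition LambdaQ n p := freeQ1 p /\ homogR n p.

Lemma homogDiff_homogR n p : homogDiff 0 n p <-> homogR n p.
Proof. by split=> h m /h; rewrite ?addn0. Qed.

Lemma LambdaQ0 n : LambdaQ n 0.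
Proof. by split=> m; rewrite msupp0. Qed.

Lemma LambdaQP n c p q : LambdaQ n p -> LambdaQ n q -> LambdaQ n (c *: p + q).
Proof.
move=> [fp hp] [fq hq]; split=> m /(fsubsetP (msuppD_le _ _)); rewrite inE => /orP[].
- by move=> /(fsubsetP (msuppZ_le c p)); apply: fp.
- exact: fq.
- by move=> /(fsubsetP (msuppZ_le c p)); apply: hp.
- exact: hq.
Qed.

Lemma LambdaQ_Q2M n p : LambdaQ n p -> LambdaQ n.+2 (varQ 2 * p).
Proof.
move=> [fp hp]; split=> m /msupp_varQM[m' mp ->]; first by rewrite mulcmE ucmE fp.
by rewrite mweight_mulcm hp.
Qed.

Lemma LambdaQ_LaplaceQ n p : LambdaQ n.+2 p -> LambdaQ n (LaplaceQ p).
Proof.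
move=> [_ /homogDiff_homogR/homogDiff_Delta/homogDiff_killQ1 h]; split.
  exact: freeQ1_killQ1.
by move=> m /h; lia.
Qed.

(** A monomial of the image would have weight [n - 2], which is negative, so the support is
    empty. *)
Lemma LaplaceQ_small n p : (n < 2)%N -> LambdaQ n p -> LaplaceQ p = 0.
Proof.
move=> n2 [_ /homogDiff_homogR/homogDiff_Delta/homogDiff_killQ1 h].
by rewrite /LaplaceQ /= [LHS]monalgE big1_seq // => m /andP[_ /h]; lia.
Qed.

Lemma LambdaQ_decomp n f : LambdaQ n f ->
  exists h : nat -> Rring,
    (forall i, (i <= n./2)%N -> LambdaQ (n - 2 * i) (h i) /\ LaplaceQ (h i) = 0) /\
    f = \sum_(i < (n./2).+1) varQ 2 ^+ i * h i.
Proof.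
apply: (harmonic_decomp LambdaQ0 LambdaQP LambdaQ_Q2M LambdaQ_LaplaceQ LaplaceQ_small).
by move=> k p [fp hp]; apply: LaplaceQ_Q2M.
Qed.

Lemma LambdaQ_decomp_unique K (h : nat -> Rring) (w : nat -> nat) :
  (forall i, (i < K)%N -> LambdaQ (w i) (h i) /\ LaplaceQ (h i) = 0) ->
  \sum_(i < K) varQ 2 ^+ i * h i = 0 -> forall i, (i < K)%N -> h i = 0.
Proof.
apply: (harmonic_decomp_unique LambdaQ0 LambdaQP LambdaQ_Q2M).
by move=> k p [fp hp]; apply: LaplaceQ_Q2M.
Qed.

(** * Evaluation *)

Definition mpow (S : comNzRingType) (v : nat -> S) (m : {cmonom nat}) : S :=
  \prod_(i <- finsupp m) v i ^+ m i.

(** The target ring is general so that values can be rational numbers or polynomials in one moving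
    point. *)
Definition evalQ (S : comNzRingType) (f : {rmorphism rat -> S}) (v : nat -> S)
  (p : Rring) : S := mmap f (mpow v) p.

Lemma mpowE (S : comNzRingType) (v : nat -> S) N (m : {cmonom nat}) :
  (forall i, (N <= i)%N -> m i = 0%N) -> mpow v m = \prod_(i < N) v i ^+ m i.
Proof.
move=> h; rewrite /mpow -(big_mkord xpredT (fun i => v i ^+ m i)).
rewrite [RHS](bigID (fun i => i \in finsupp m)) /= [X in _ * X]big1 ?mulr1; last first.
  by move=> i; rewrite -cmE_eq0 => /eqP ->; rewrite expr0.
rewrite -[RHS]big_filter; apply: perm_big; apply: uniq_perm.
- exact: fset_uniq.
- by rewrite filter_uniq // iota_uniq.
move=> i; rewrite mem_filter mem_index_iota /=; case: (boolP (i \in _)) => //=.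
rewrite -cmE_neq0 => mi; symmetry; rewrite ltnNge; apply: contra mi => /h ->.
by [].
Qed.

Lemma mpow_mulcm (S : comNzRingType) (v : nat -> S) j m :
  mpow v (mulcm (ucm j) m) = v j * mpow v m.
Proof.
have [N hN] := finsupp_bound m.
have le1 := leq_maxl N j.+1; have le2 := leq_maxr N j.+1.
rewrite (@mpowE _ _ (maxn N j.+1)); last first.
  move=> i hi; rewrite mulcmE ucmE hN ?(leq_trans le1) // addn0.
  by case: eqP => // E; move: (leq_trans le2 hi); rewrite E ltnn.
rewrite (@mpowE _ _ (maxn N j.+1) m); last by move=> i /(leq_trans le1)/hN.
under eq_bigr do rewrite mulcmE exprD.
rewrite big_split /=; congr (_ * _).
rewrite (bigD1 (Ordinal le2)) //= ucmE eqxx expr1 big1 ?mulr1 // => i.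
by rewrite -val_eqE /= eq_sym ucmE => /negPf ->; rewrite expr0.
Qed.

Lemma mpow1 (S : comNzRingType) (v : nat -> S) : mpow v (onecm nat) = 1.
Proof. by rewrite (@mpowE _ _ 0) ?big_ord0 // => i _; rewrite onecmE. Qed.

Lemma cmonom_ind (P : {cmonom nat} -> Prop) : P (onecm nat) ->
  (forall j m, P m -> P (mulcm (ucm j) m)) -> forall m, P m.
Proof.
move=> P1 PM m; move: {2}(mdeg m) (erefl (mdeg m)) => d.
elim: d m => [|d IH] m dm; first by rewrite (mdeg_eq0I dm).
have [j mj] : exists j, m j != 0%N.
  case: (finsupp m =P fset0) => [E|/eqP/fset0Pn[j jm]]; last by exists j; rewrite cmE_neq0.
  by move: dm; rewrite mdegE E big_seq_fset0.
rewrite -(mulcm_divcm mj); apply: PM; apply: IH; apply: succn_inj.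
by rewrite -dm -[in RHS](mulcm_divcm mj) [RHS]mdegM [X in (X + _)%N]mdegU.
Qed.

Section EvalTheory.
Variables (S : comNzRingType) (f : {rmorphism rat -> S}) (v : nat -> S).

Lemma evalQD : {morph evalQ f v : p q / p + q}.
Proof. exact: mmapD. Qed.

Lemma evalQN p : evalQ f v (- p) = - evalQ f v p.
Proof. exact: mmapN. Qed.

Lemma evalQ_sum (I : Type) (r : seq I) (F : I -> Rring) :
  evalQ f v (\sum_(i <- r) F i) = \sum_(i <- r) evalQ f v (F i).
Proof. exact: (raddf_sum (mmap f (mpow v))). Qed.

Lemma evalQ0 : evalQ f v 0 = 0.
Proof. exact: mmap0. Qed.

Lemma evalQMn n p : evalQ f v (p *+ n) = evalQ f v p *+ n.
Proof. exact: mmapMn. Qed.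

Lemma evalQU c m : evalQ f v << c *g m >> = f c * mpow v m.
Proof. exact: mmapU. Qed.

Lemma evalQ_varQM j p : evalQ f v (varQ j.+1 * p) = v j * evalQ f v p.
Proof.
move: p; apply: additive_ext => [p q|p q|c m].
- by rewrite mulrDr evalQD.
- by rewrite evalQD mulrDr.
by rewrite varQSU [LHS]evalQU [evalQ _ _ _]evalQU mpow_mulcm mulrCA.
Qed.

Lemma eq_evalQ v' : v =1 v' -> evalQ f v =1 evalQ f v'.
Proof.
move=> e p; apply: eq_bigr => m _; congr (_ * _).
by apply: eq_bigr => i _; rewrite e.
Qed.

End EvalTheory.

Lemma evalQ_horner (v : nat -> {poly rat}) t p :
  (evalQ (polyC : {rmorphism rat -> {poly rat}}) v p).[t] =
  evalQ idfun (fun i => (v i).[t]) p.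
Proof.
move: p; apply: additive_ext => [p q|p q|c m].
- by rewrite evalQD hornerD.
- exact: evalQD.
rewrite [X in X.[t]]evalQU [RHS]evalQU hornerM hornerC /mpow horner_prod.
by under eq_bigr do rewrite horner_exp.
Qed.

(** Restricting the test to the support of [p] lets a bound on the variables of [p] be used term by
    term. *)
Lemma additive_ext_in (V : zmodType) (f g : Rring -> V) p :
  {morph f : p q / p + q} -> {morph g : p q / p + q} ->
  (forall c m, m \in msupp p -> f << c *g m >> = g << c *g m >>) -> f p = g p.
Proof.
move=> fD gD h; have F0 : f 0 = 0 by apply: (addrI (f 0)); rewrite -fD !addr0.
have G0 : g 0 = 0 by apply: (addrI (g 0)); rewrite -gD !addr0.
rewrite [p]monalgE (big_morph f fD F0) (big_morph g gD G0) big_seq [RHS]big_seq.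
by apply: eq_bigr => m mp; rewrite h.
Qed.

(** The chain rule, proved on each monomial by adjoining one variable at a time. *)
Lemma deriv_evalQ (v : nat -> {poly rat}) N p : bounded N p ->
  (evalQ (polyC : {rmorphism rat -> {poly rat}}) v p)^`() =
  \sum_(i < N) evalQ (polyC : {rmorphism rat -> {poly rat}}) v (partialQ i p) * (v i)^`().
Proof.
set ev := evalQ _ v => b.
apply: (additive_ext_in (f := fun p => (ev p)^`())
  (g := fun p => \sum_(i < N) ev (partialQ i p) * (v i)^`())) => [q r|q r|c m mp].
- by rewrite /ev evalQD derivD.
- rewrite -big_split; apply: eq_bigr => i _ /=.
  have -> : partialQ i (q + r) = partialQ i q + partialQ i r by exact: linearD.
  by rewrite /ev evalQD mulrDl.
have := b m mp; elim/cmonom_ind: m {mp} => [_|j m IH hN].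
  rewrite /ev evalQU mpow1 mulr1 derivC big1 // => i _.
  have -> : partialQ i << c *g onecm nat >> = 0.
    by rewrite partialQU onecmE mulr0n monalgU0.
  by rewrite evalQ0 mul0r.
have jN : (j < N)%N.
  by rewrite ltnNge; apply/negP => /hN/eqP; rewrite mulcmE ucmE eqxx.
have hm i : (N <= i)%N -> m i = 0%N.
  by move=> /hN/eqP; rewrite mulcmE addn_eq0 => /andP[_ /eqP].
rewrite -varQSU /ev evalQ_varQM derivM -/ev (IH hm).
under [RHS]eq_bigr => i _.
  rewrite partialQ_varQM /ev evalQD evalQMn evalQ_varQM mulrDl mulrnAl -mulrA. over.
rewrite big_split [X in _ + X = _]mulr_sumr /=; congr (_ + _).
rewrite (bigD1 (Ordinal jN)) //= eqxx mulr1n [X in _ = _ + X]big1 => [|i].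
  by rewrite addr0; exact: mulrC.
by rewrite -val_eqE /= => /negPf ->; rewrite mulr0n.
Qed.

(** * Algebraic independence on partitions *)

(** The Taylor series of $z/(2\sinh(z/2))$. *)
Definition betaQ : fps :=
  fps_inv (fps_divX (fps_sub (fps_exp (1 / 2%:R)) (fps_exp (- (1 / 2%:R))))).

Lemma fps_mul_exp0 (b : fps) k : fps_mul (fps_exp 0) b k = b k.
Proof.
rewrite /fps_mul big_ord_recl /fps_exp expr0 fact0 divr1 mul1r subn0 big1 ?addr0 // => i _.
by rewrite /= /bump /= add1n expr0n /= !mul0r.
Qed.

Lemma slength_le (la : int_partition) M :
  (forall i, (M <= i)%N -> pterm la i = 0%N) -> (slength la <= M)%N.
Proof.
by move=> h; rewrite /slength; case: ex_minnP => n _; apply; rewrite /= h.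
Qed.

Lemma slength_stable (la : int_partition) i : (slength la <= i)%N -> pterm la i = 0%N.
Proof.
rewrite /slength; case: ex_minnP => n /= /eqP[n0] _ /(pterm_nonincr la).
by rewrite n0 leqn0 => /eqP.
Qed.

(** The eventual value is 0, so the exponential prefactor is 1; beyond the length of the partition
    the two sums have equal terms, so any [M] bounding the number of parts may be used. *)
Lemma Q_partition (la : int_partition) M k :
  (forall i, (M <= i)%N -> pterm la i = 0%N) ->
  Q k.+1 la = betaQ k.+1 - \sum_(j < M) fps_exp (- j%:R - 1 / 2%:R) k
              + \sum_(j < M) fps_exp ((pterm la j)%:R - j%:R - 1 / 2%:R) k.
Proof.
move=> h; rewrite /Q /Qseries /= fps_mul_exp0 /fps_add -/betaQ -addrA; congr (_ + _).
rewrite /= addrC -sumrB.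
pose F j := fps_exp ((pterm la j)%:R - j%:R - 1 / 2%:R) k - fps_exp (- j%:R - 1 / 2%:R) k.
transitivity (\sum_(j < slength la) F j).
  by apply: eq_bigr => j _; rewrite /fps_sub subr0.
rewrite (big_ord_widen _ F (slength_le h)) [RHS](bigID (fun j : 'I_M => (j < slength la)%N)) /=.
rewrite [X in _ = _ + X]big1 ?addr0 // => j; rewrite -leqNgt => /slength_stable ->.
by rewrite sub0r subrr.
Qed.

(** The power sums of exponent 0 both count [M] points and cancel, and the linear coefficient of the
    even series [betaQ] is 0. *)
Lemma Q1_partition (la : int_partition) : Q 1 la = 0.
Proof.
have [M hM] := pterm_stable la.
rewrite (Q_partition 0 hM).
rewrite [X in _ + X](eq_bigr (fun j : 'I_M => fps_exp (- j%:R - 1 / 2%:R) 0)); last first.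
  by move=> j _; rewrite /fps_exp !expr0.
rewrite subrK /betaQ /fps_inv /= big_ord1 /= /fps_divX /fps_sub /fps_exp.
by rewrite sqrrN subrr mul0r mulr0.
Qed.

(* Adding M - 1/2 to the numbers la_i - i + 1/2, i = 1, .., M, turns partitions
   with at most M parts into M-element sets of natural numbers. *)
Definition configQ M (a : seq nat) (k : nat) : rat :=
  betaQ k.+1 - \sum_(j < M) fps_exp (- j%:R - 1 / 2%:R) k
  + \sum_(x <- a) fps_exp (x%:R - M%:R + 1 / 2%:R) k.

Lemma partition_of_config (a : seq nat) : uniq a ->
  exists la : int_partition, forall k, Q k.+1 la = configQ (size a) a k.
Proof.
move=> ua; set M := size a; pose b := sort leq a.
have sb : size b = M by rewrite size_sort.
have ltb : sorted ltn b.
  by rewrite ltn_sorted_uniq_leq sort_uniq ua sort_sorted //; apply: leq_total.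
have bS p : (p.+1 < M)%N -> (nth 0 b p < nth 0 b p.+1)%N.
  move=> pM; apply: (sorted_ltn_nth ltn_trans 0%N ltb) => //; rewrite inE sb //; exact: ltnW.
(* Strictly increasing naturals grow by at least [d] in [d] steps. This makes the parts [t]
   non-increasing and, from [q = 0], ensures that their subtraction does not truncate. *)
have bmono q d : (q + d < M)%N -> (nth 0 b q + d <= nth 0 b (q + d))%N.
  elim: d => [|d IH]; first by rewrite !addn0.
  rewrite !addnS => lt; apply: leq_ltn_trans (bS _ lt); apply: IH; exact: ltnW.
(* Parts decrease while [b] increases, hence the reversed index; subtracting the position removes
   the staircase. *)
pose t i := if (i < M)%N then (nth 0 b (M.-1 - i) - (M.-1 - i))%N else 0%N.
have tmono i j : (i <= j)%N -> (t j <= t i)%N.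
  move=> ij; rewrite /t; case: ltnP => // jM; rewrite (leq_ltn_trans ij jM).
  have := bmono (M.-1 - j)%N (j - i)%N.
  have -> : (M.-1 - j + (j - i) = M.-1 - i)%N by lia.
  lia.
have tst : exists N, forall i, (N <= i)%N -> t i = 0%N.
  by exists M => i; rewrite /t ltnNge => ->.
exists (IntPartition tmono tst) => k.
rewrite (@Q_partition _ M) /=; last by move=> i; rewrite /t ltnNge => ->.
rewrite /configQ; congr (_ + _).
have -> : \sum_(x <- a) fps_exp (x%:R - M%:R + 1 / 2%:R) k
        = \sum_(x <- b) fps_exp (x%:R - M%:R + 1 / 2%:R) k.
  by apply: perm_big; rewrite perm_sym perm_sort.
rewrite (big_nth 0%N) sb big_mkord (reindex_inj rev_ord_inj) /=.
apply: eq_bigr => i _; congr (fps_exp _ k).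
have iM := ltn_ord i; rewrite /t; have -> : (M - i.+1 < M)%N by lia.
have -> : (M.-1 - (M - i.+1) = i)%N by lia.
have := bmono 0%N i; rewrite add0n => /(_ iM) le.
rewrite natrB; last by lia.
by rewrite natrB // -natr1; field.
Qed.

Lemma poly_nat_roots (F : {poly rat}) B :
  (forall n, (B <= n)%N -> F.[n%:R] = 0) -> F = 0.
Proof.
move=> h; apply: (@roots_geq_poly_eq0 _ F [seq n%:R | n <- iota B (size F)]).
- by apply/allP => y /mapP[n]; rewrite mem_iota => /andP[Bn _] ->; apply/rootP/h.
- by rewrite map_inj_uniq ?iota_uniq // => m n /eqP; rewrite eqr_nat => /eqP.
by rewrite size_map size_iota.
Qed.

(** In characteristic 0, a derivative in a variable occurring in [m] multiplies the coefficient of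
    [m] by a nonzero exponent, so that coefficient vanishes. *)
Lemma partialQ_eq0_const p : (forall i, partialQ i p = 0) ->
  p = << p@_(onecm nat) *g onecm nat >>.
Proof.
move=> h; apply/malgP => m; rewrite [RHS]mcoeffU.
have [<-|m1] := eqVneq (onecm nat) m; first by rewrite mulr1n.
have [j mj] : exists j, m j != 0%N.
  case: (finsupp m =P fset0) => [E|/eqP/fset0Pn[j jm]]; last by exists j; rewrite cmE_neq0.
  by case/eqP: m1; symmetry; apply: mdeg_eq0I; rewrite mdegE E big_seq_fset0.
have := mcoeff_partialQ j p (divcm m (ucm j)).
rewrite h mcoeff0 mulcm_divcm // mulr0n => /esym/eqP.
by rewrite mulrn_eq0 /= => /eqP.
Qed.

Lemma msupp_partialQ i p m : m \in msupp (partialQ i p) -> mulcm (ucm i) m \in msupp p.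
Proof.
rewrite -!mcoeff_neq0 mcoeff_partialQ; apply: contra_neq => ->.
by rewrite mul0rn.
Qed.

(** * Polynomials vanishing on all configurations of [M] points *)

Section Vanishing.
Variables (M : nat) (p : Rring).
Hypothesis fp : freeQ1 p.
(** With $Q_1$ absent, the possible variables are $Q_2,\ldots,Q_{M+1}$: as many as there are points,
    so the linear system below is square. *)
Hypothesis bp : bounded M.+1 p.
Hypothesis vp : forall a, uniq a -> size a = M -> evalQ idfun (configQ M a) p = 0.

Lemma partialQ0_freeQ1 : partialQ 0 p = 0.
Proof.
by rewrite /partialQ big1_seq // => m /andP[_ /fp ->]; rewrite mulr0n monalgU0.
Qed.

(* Moving one point of the configuration far to the right stays among the
   configurations, so p vanishes identically in that point and may be
   differentiated with respect to it. *)
Lemma evalQ_partialQ_relation a x : uniq a -> size a = M -> x \in a ->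
  \sum_(i < M) evalQ idfun (configQ M a) (partialQ i.+1 p)
     * fps_exp (x%:R - M%:R + 1 / 2%:R) i = 0.
Proof.
move=> ua sa xa; pose a' := rem x a.
have pa : perm_eq a (x :: a') by apply: perm_to_rem.
have ua' : uniq a' by apply: rem_uniq.
have sa' : (size a').+1 = M by rewrite -sa (perm_size pa).
pose c : rat := M%:R - 1 / 2%:R.
(* The values of the configuration with the point [x] replaced by the indeterminate; the shift still
   uses [M], although [a'] has one point fewer. *)
pose v k : {poly rat} := (configQ M a' k)%:P + (k`!%:R)^-1 *: ('X - c%:P) ^+ k.
have vE y k : (v k).[y%:R] = configQ M (y :: a') k.
  rewrite /v /configQ big_cons hornerD hornerC hornerZ horner_exp hornerXsubC.
  rewrite /fps_exp /c opprB addrA addrAC [X in _ = _ + X]addrC -!addrA; congr (_ + (_ + (_ + _))).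
  by rewrite mulrC.
have evE y q : (evalQ (polyC : {rmorphism rat -> {poly rat}}) v q).[y%:R] =
    evalQ idfun (configQ M (y :: a')) q.
  by rewrite evalQ_horner; apply: eq_evalQ => k; apply: vE.
(* Every natural number larger than all points of [a'] completes it to a configuration, which gives
   infinitely many roots. *)
have F0 : evalQ (polyC : {rmorphism rat -> {poly rat}}) v p = 0.
  apply: (@poly_nat_roots _ (\max_(y <- a') y).+1) => n hn; rewrite evE vp //=.
  rewrite ua' andbT; apply/negP => na'; move: hn.
  by rewrite (big_rem _ na') /= ltnNge leq_maxl.
(* The polynomial is identically zero, so its derivative may be evaluated at the original point [x],
   however small. *)
have := deriv_evalQ v bp; rewrite F0 deriv0 => /(congr1 (fun q : {poly rat} => q.[x%:R])).
rewrite horner0 horner_sum big_ord_recl partialQ0_freeQ1 evalQ0 mul0r horner0 add0r => E.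
rewrite [RHS]E; apply: eq_bigr => i _; rewrite hornerM evE lift0; congr (_ * _).
  by apply: eq_evalQ => k; rewrite /configQ (perm_big _ pa).
have -> : (v i.+1)^`() = (i.+1`!%:R)^-1 *: (('X - c%:P) ^+ i *+ i.+1).
  by rewrite /v derivD derivC add0r derivZ deriv_exp derivXsubC mul1r.
have -> : x%:R - M%:R + 1 / 2%:R = x%:R - c by rewrite /c opprB addrA addrAC.
rewrite hornerZ hornerMn horner_exp hornerXsubC /fps_exp factS natrM -[X in _ = _ * X]mulr_natr.
have a0 : (i.+1%:R : rat) != 0 by rewrite pnatr_eq0.
have b0 : (i`!%:R : rat) != 0 by rewrite pnatr_eq0 -lt0n fact_gt0.
move: (_ ^+ i) (i.+1%:R) (i`!%:R) a0 b0 => y r s r0 s0.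
by field; rewrite r0 s0.
Qed.

Lemma evalQ_partialQ_eq0 a i : uniq a -> size a = M ->
  evalQ idfun (configQ M a) (partialQ i p) = 0.
Proof.
move=> ua sa; case: i => [|i]; first by rewrite partialQ0_freeQ1 evalQ0.
have [Mi|iM] := leqP M i; first by rewrite (partialQ_bounded0 bp) ?evalQ0.
(* The Vandermonde argument: the [M] relations say that [G], of degree less than [M], vanishes at
   the [M] distinct shifted points. *)
pose G := \poly_(i < M) (evalQ idfun (configQ M a) (partialQ i.+1 p) / i`!%:R).
have G0 : G = 0.
  pose r := [seq (x%:R - M%:R + 1 / 2%:R : rat) | x <- a].
  apply: (@roots_geq_poly_eq0 _ G r); last by rewrite size_map sa size_poly.
    apply/allP => y /mapP[x xa ->]; apply/rootP; rewrite horner_poly.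
    rewrite -[RHS](evalQ_partialQ_relation ua sa xa); apply: eq_bigr => j _.
    by rewrite /fps_exp -mulrA [_ * _ ^+ _]mulrC.
  by rewrite map_inj_uniq // => x y /addIr/addIr/eqP; rewrite eqr_nat => /eqP.
have /eqP : G`_i = 0 by rewrite G0 coef0.
by rewrite coef_poly iM mulf_eq0 invr_eq0 pnatr_eq0 eqn0Ngt fact_gt0 orbF => /eqP.
Qed.

End Vanishing.

(** With [M] fixed, the partial derivatives satisfy the same hypotheses in smaller degree, so [p] is
    constant; any one configuration then shows that the constant is 0. *)
Lemma vanishing_on_configs M d p : freeQ1 p -> bounded M.+1 p ->
  (forall m, m \in msupp p -> (mdeg m < d)%N) ->
  (forall a, uniq a -> size a = M -> evalQ idfun (configQ M a) p = 0) -> p = 0.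
Proof.
elim: d p => [|d IH] p fp bp dp vp.
  by apply/eqP; rewrite -msupp_eq0; apply/eqP/fsetP => m; rewrite in_fset0; apply/negP => /dp.
have dp0 i : partialQ i p = 0.
  apply: IH.
  - by move=> m /msupp_partialQ/fp/eqP; rewrite mulcmE addn_eq0 => /andP[_ /eqP].
  - exact: bounded_partialQ.
  - move=> m /msupp_partialQ/dp.
    by rewrite [mdeg _]mdegM [X in (X + _)%N]mdegU.
  - by move=> a ua sa; apply: evalQ_partialQ_eq0.
have pE := partialQ_eq0_const dp0.
have := vp (iota 0 M) (iota_uniq _ _) (size_iota _ _).
rewrite pE evalQU mpow1 mulr1 => /= ->.
exact: monalgU0.
Qed.

Lemma evalR_inj p : freeQ1 p -> (forall la : int_partition, evalR p la = 0) -> p = 0.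
Proof.
(* The number of points is chosen as [M = nvars p]. *)
move=> fp vp; have bp := bounded_le (leqnSn _) (@bounded_nvars p).
apply: (vanishing_on_configs (d := (\max_(m <- msupp p) mdeg m).+1) fp bp).
  by move=> m mp; rewrite ltnS (big_rem _ mp) leq_maxl.
move=> a ua sa; have [la E] := partition_of_config ua.
by rewrite -[RHS](vp la); apply: eq_evalQ => k; rewrite E sa.
Qed.

(** * The decomposition for functions on partitions *)

Lemma evalRD p q s : evalR (p + q) s = evalR p s + evalR q s.
Proof. exact: evalQD. Qed.

Lemma evalR_varQM j p s : evalR (varQ j.+1 * p) s = Q j.+1 s * evalR p s.
Proof. exact: (evalQ_varQM idfun (fun i => Q i.+1 s)). Qed.

Lemma evalR_Q2XM i p s : evalR (varQ 2 ^+ i * p) s = Q 2 s ^+ i * evalR p s.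
Proof.
elim: i => [|i IH]; first by rewrite !expr0 !mul1r.
by rewrite !exprS -[X in evalR X]mulrA evalR_varQM IH mulrA.
Qed.

Lemma evalR_killQ1 p (la : int_partition) : evalR (killQ1 p) la = evalR p la.
Proof.
have [q E] := killQ1_mod p.
by rewrite [in RHS]E evalRD evalR_varQM Q1_partition mul0r addr0.
Qed.

(** Multiples of $Q_1$ vanish on partitions, so there [LaplaceQ p] evaluates to 0 and is the zero
    polynomial by [evalR_inj]. The converse is [killQ1_mod]. *)
Lemma in_Q1R_Delta p : in_Q1R (evalR (Delta p)) <-> LaplaceQ p = 0.
Proof.
split=> [[q E]|L0].
  apply: evalR_inj => [|la]; first exact: freeQ1_killQ1.
  by rewrite [LHS]evalR_killQ1 E Q1_partition mul0r.
have [q E] := killQ1_mod (Delta p); exists q => s.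
rewrite E [killQ1 _]L0 evalRD evalR_varQM.
by rewrite [X in X + _](evalQ0 idfun) add0r.
Qed.

Lemma LambdaQ_eval_inj n p q : LambdaQ n p -> LambdaQ n q ->
  (forall la : int_partition, evalR p la = evalR q la) -> p = q.
Proof.
move=> Lp Lq e; apply/eqP; rewrite -subr_eq0; apply/eqP.
apply: evalR_inj => [|la].
  by rewrite -scaleN1r addrC; case: (LambdaQP (-1) Lq Lp).
by rewrite evalRD [X in _ + X]evalQN -[evalQ _ _ _]/(evalR q la) e subrr.
Qed.

(** Harmonicity and weight each come with their own representing polynomial; by [evalR_inj] the two
    coincide. *)
Lemma in_H_wtP n f : in_H_wt n f <->
  exists p, [/\ LambdaQ n p, LaplaceQ p = 0 & forall la : int_partition, f la = evalR p la].
Proof.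
split=> [[[p [fp ep] Hp] [q [fq eq] hq]]|[p [[fp hp] Lp ep]]]; last first.
  by split; exists p => //; apply/in_Q1R_Delta.
exists q; split=> //; suff <- : p = q by apply/in_Q1R_Delta.
apply/eqP; rewrite -subr_eq0; apply/eqP; apply: evalR_inj => [m|la].
  by move/(fsubsetP (msuppB_le p q)); rewrite inE => /orP[/fp|/fq].
by rewrite evalRD [X in _ + X]evalQN -[evalQ _ _ _]/(evalR q la) -ep -eq subrr.
Qed.

Lemma evalR_decomp K (h : 'I_K -> Rring) s :
  evalR (\sum_(i < K) varQ 2 ^+ i * h i) s = \sum_(i < K) Q 2 s ^+ i * evalR (h i) s.
Proof.
rewrite [LHS](evalQ_sum idfun (fun i => Q i.+1 s)).
by apply: eq_bigr => i _; apply: evalR_Q2XM.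
Qed.

Lemma LambdaQ_sum_Q2XM n (h : 'I_(n./2).+1 -> Rring) :
  (forall i : 'I_(n./2).+1, LambdaQ (n - 2 * i) (h i)) ->
  LambdaQ n (\sum_(i < (n./2).+1) varQ 2 ^+ i * h i).
Proof.
move=> hL; elim/big_ind: _ => [|p q Lp Lq|i _]; first exact: LambdaQ0.
  by rewrite -[p]scale1r; apply: LambdaQP.
have := V_xnM LambdaQ_Q2M i (hL i); congr LambdaQ.
by have := leq_ord i; lia.
Qed.

Theorem theorem1p3 (n : nat) (f : int_partition -> rat) :
  in_Lambda_wt n f ->
  exists! h : 'I_(n./2).+1 -> int_partition -> rat,
    (forall i : 'I_(n./2).+1, in_H_wt (n - 2 * i)%N (h i)) /\
    (forall la : int_partition,
       f la = \sum_(i < (n./2).+1) Q 2 la ^+ i * h i la).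
Proof.
move=> [p [fp ep] hp]; have [g [gL pE]] := LambdaQ_decomp (conj fp hp).
have gL' (i : 'I_(n./2).+1) := gL i (leq_ord i).
exists (fun i la => evalR (g i) la); split.
  split=> [i|la]; last by rewrite ep pE evalR_decomp.
  by have [Lg Lg0] := gL' i; apply/in_H_wtP; exists (g i).
move=> h' [hH hE].
have [g' g'L] := fin_all_exists (fun i => proj1 (in_H_wtP _ _) (hH i)).
have Lp : LambdaQ n p by [].
(* The identity between functions lifts to polynomials, both sides being of weight [n] and free of
   $Q_1$. *)
have pE' : p = \sum_(i < (n./2).+1) varQ 2 ^+ i * g' i.
  apply: (LambdaQ_eval_inj Lp) => [|la].
    by apply: LambdaQ_sum_Q2XM => i; have [] := g'L i.
  rewrite -ep hE evalR_decomp; apply: eq_bigr => i _.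
  by have [_ _ ->] := g'L i.
(* [inord] turns the ordinal-indexed family into one indexed by naturals, as the uniqueness lemma
   requires; only indices in range matter. *)
pose d i := g i - g' (inord i).
have d0 i : (i < (n./2).+1)%N -> d i = 0.
  apply: (@LambdaQ_decomp_unique _ d (fun i => n - 2 * i)%N) => [j jn|].
    have [Lg Lg0] := gL j jn; have [Lg' Lg'0 _] := g'L (inord j).
    have Ej := inordK jn; rewrite Ej in Lg'.
    split; first by rewrite /d -scaleN1r addrC; apply: LambdaQP.
    have -> : LaplaceQ (d j) = LaplaceQ (g j) - LaplaceQ (g' (inord j)) by exact: linearB.
    by rewrite Lg0 Lg'0 subrr.
  transitivity (p - p); last by rewrite subrr.
  rewrite [X in X - _]pE [X in _ - X]pE' -sumrB; apply: eq_bigr => j _.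
  by rewrite /d inord_val mulrBr.
apply: functional_extensionality => i; apply: functional_extensionality => la.
have [_ _ ->] := g'L i; congr (evalR _ la); apply/eqP; rewrite -subr_eq0.
by have := d0 i (ltn_ord i); rewrite /d inord_val => ->.
Qed.
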